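(* Let $A, B$ be real numbers with $A^{2}+4B>0$, and let $x_{-}<x_{+}$ be the two real solutions of the equation $x^{2}=Ax+B$. Let $(a_{n})_{n\ge 0}$ be a sequence of real numbers. The following statements are equivalent: (1) $a_{n}=A a_{n-1}+B a_{n-2}$ for all integers $n\ge 2$; (2) there exist real numbers $a, b$ such that $a_{n}=a\,x_{+}^{n}+b\,x_{-}^{n}$ for all integers $n\ge 0$.
   Context: Convention: $x^{0}=1$ for every real $x$, including $x=0$. *)

(* Defs.v *)
From Stdlib Require Import Reals.

(* Main.v *)
Require Import Defs.
From Stdlib Require Import Reals.
From Stdlib Require Import Lra Lia.
Open Scope R_scope.

(** The recurrence is linear, and multiplying [x ^ 2 = A * x + B] by [x ^ n] shows that the powers
    of either root satisfy it ([pow_SS_of_root]); hence so do their combinations. Conversely, a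
    solution is determined by its first two terms ([recurrence2_unique]), and since the roots are
    distinct some combination matches any two initial values. *)

Lemma pow_SS_of_root (A B x : R) (n : nat) :
  x ^ 2 = A * x + B -> x ^ S (S n) = A * x ^ S n + B * x ^ n.
Proof.
intros Hx.
replace (x ^ S (S n)) with (x ^ 2 * x ^ n) by (simpl; ring).
rewrite Hx; simpl; ring.
Qed.

(** The recurrence looks back two steps, so the induction carries agreement at two consecutive
    indices. *)
Lemma recurrence2_unique (A B : R) (a b : nat -> R) :
  (forall n, a (S (S n)) = A * a (S n) + B * a n) ->
  (forall n, b (S (S n)) = A * b (S n) + B * b n) ->
  a 0%nat = b 0%nat -> a 1%nat = b 1%nat ->
  forall n, a n = b n.
Proof.
intros Ha Hb H0 H1 n.
enough (a n = b n /\ a (S n) = b (S n)) by tauto.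
induction n as [|n [IH IHS]]; [easy|].
split; [easy|].
now rewrite Ha, Hb, IH, IHS.
Qed.

Theorem theorem2 :
  forall (A B : R), A ^ 2 + 4 * B > 0 ->
  forall (xm xp : R), xm < xp ->
  (forall x : R, x ^ 2 = A * x + B <-> x = xm \/ x = xp) ->
  forall a : nat -> R,
    (forall n : nat, (2 <= n)%nat ->
       a n = A * a (n - 1)%nat + B * a (n - 2)%nat)
    <->
    (exists c d : R, forall n : nat, a n = c * xp ^ n + d * xm ^ n).
Proof.
intros A B _ xm xp Hlt Hroots a.
assert (Hm : xm ^ 2 = A * xm + B) by (apply Hroots; now left).
assert (Hp : xp ^ 2 = A * xp + B) by (apply Hroots; now right).
(* Serves both directions: as an input to uniqueness, and as the whole converse. *)
assert (Hgeom : forall c d n, c * xp ^ S (S n) + d * xm ^ S (S n) =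
    A * (c * xp ^ S n + d * xm ^ S n) + B * (c * xp ^ n + d * xm ^ n)).
{ intros c d n.
  rewrite (pow_SS_of_root A B xp n Hp), (pow_SS_of_root A B xm n Hm); ring. }
split.
- intros Ha.
  (* Cramer's rule for c + d = a 0, c xp + d xm = a 1. *)
  exists ((a 1%nat - a 0%nat * xm) / (xp - xm)),
    ((a 0%nat * xp - a 1%nat) / (xp - xm)).
  apply (recurrence2_unique A B).
  + intros n; rewrite (Ha (S (S n))) by lia.
    now replace (S (S n) - 1)%nat with (S n) by lia;
      replace (S (S n) - 2)%nat with n by lia.
  + intros n; apply Hgeom.
  (* Initial values at 0 and 1; [Hlt] makes the denominator [xp - xm] nonzero, and [x ^ 0 = 1]
     covers a zero root. *)
  + simpl; field; lra.
  + simpl; field; lra.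
- intros (c & d & Ha) n Hn.
  destruct n as [|[|n]]; [lia|lia|].
  replace (S (S n) - 1)%nat with (S n) by lia.
  replace (S (S n) - 2)%nat with n by lia.
  rewrite !Ha; apply Hgeom.
Qed.
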